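(* There is an absolute constant $C>0$ such that for every integer $q\geq 4$, every positive integer $N$, and every coloring of the edges of the complete graph on vertex set $[N]$ with $q$ colors, there exists a color-avoiding monotone path with at least $N^{1-C/\sqrt{\log q}}$ vertices.
   Context: Logarithms are to base $2$. A path in the complete graph on $[N]$ is monotone if its vertices, in the order they are traversed, are strictly increasing integers. The length of a path is its number of vertices. With colors from the palette $[q]$, a path is color-avoiding if some color of $[q]$ does not appear on any of its edges (i.e. it uses at most $q-1$ colors). *)

(* Defs.v *)
From Stdlib Require Import Reals Lra Lia List.
Import ListNotations.
Open Scope R_scope.

Definition log2 (x : R) : R := ln x / ln 2.

(* An edge coloring of K_N on [N] = {1,...,N} with palette [q], encoded
   as a function on pairs; the color of edge {i,j} with i < j is c i j,
   and colors are represented as 0,...,q-1 (i.e. [q] shifted by one). *)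
Definition is_coloring (N q : nat) (c : nat -> nat -> nat) : Prop :=
  forall i j : nat, (1 <= i)%nat -> (i < j)%nat -> (j <= N)%nat -> (c i j < q)%nat.

Fixpoint strictly_increasing (p : list nat) : Prop :=
  match p with
  | [] => True
  | x :: rest =>
      match rest with
      | [] => True
      | y :: _ => (x < y)%nat /\ strictly_increasing rest
      end
  end.

Definition monotone_path (N : nat) (p : list nat) : Prop :=
  p <> [] /\ (forall v, In v p -> (1 <= v)%nat /\ (v <= N)%nat) /\ strictly_increasing p.

Fixpoint edge_colors (c : nat -> nat -> nat) (p : list nat) : list nat :=
  match p with
  | [] => []
  | x :: rest =>
      match rest with
      | [] => []
      | y :: _ => c x y :: edge_colors c rest
      end
  end.

Definition color_avoiding (q : nat) (c : nat -> nat -> nat) (p : list nat) : Prop :=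
  exists k : nat, (k < q)%nat /\ ~ In k (edge_colors c p).

(* Main.v *)
(** Put a balanced binary search tree on the vertices.  Fix a color [i]; if two
    leaves [v < w] split at the node [z], they can be joined through [z] unless
    one of the edges [vz], [zw] has color [i].  At each node one may keep only
    the left half, only the right half, or the leaves of both halves that are
    joined to [z] by a color other than [i]; the best of these choices beats
    the mixture with weights [p], [p], [1 - 2 p].  Inductively some path
    avoiding [i] is at least as long as the sum over all leaves of the product,
    over the ancestors, of [p] (edge of color [i]) or [1 - p] (other color).
    Each edge has only one color, so for [p = 1/q] the AM-GM inequality over
    the [q] colors bounds one of these sums below by [N^(1 - O(log q / q))], up to a
    constant factor; for [N <= q] the path through all vertices already misses
    a color. *)
Require Import Defs.
From Stdlib Require Import Reals List.
From Stdlib Require Import Lra Lia Bool.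
Open Scope R_scope.

(** * Finite sums *)

Lemma sum_ge_exists (f : nat -> R) (M : R) (n : nat) :
  INR (S n) * M <= sum_f_R0 f n -> exists i, (i <= n)%nat /\ M <= f i.
Proof.
  induction n as [|n IH]; intros H.
  - simpl in H. exists 0%nat. split; [lia | lra].
  - destruct (Rle_lt_dec M (f (S n))) as [h|h].
    + exists (S n). auto.
    + destruct IH as [i [hi hM]].
      * rewrite (S_INR (S n)) in H. simpl sum_f_R0 in H. lra.
      * exists i. split; [lia | exact hM].
Qed.

Lemma sum_pick (k n : nat) (x y : R) :
  (k <= n)%nat ->
  sum_f_R0 (fun i => if Nat.eqb k i then x else y) n = x + INR n * y.
Proof.
  intros Hk.
  assert (H : sum_f_R0 (fun i => if Nat.eqb k i then x else y) n
              = INR (S n) * y + (if Nat.leb k n then x - y else 0)).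
  (* The induction on [n] passes below [k], so the closed form also has to cover [k > n]. *)
  { clear Hk. induction n as [|n IH].
    - destruct k; simpl; lra.
    - rewrite tech5, IH, !S_INR.
      destruct (Nat.leb_spec k n), (Nat.leb_spec k (S n)), (Nat.eqb_spec k (S n));
        try lia; lra. }
  rewrite H, S_INR. destruct (Nat.leb_spec k n); [lra | lia].
Qed.

(** AM-GM in exponential form: [exp] lies above its tangent at the mean [m], and the deviations
    [u i - m] have a nonnegative sum. *)
Lemma sum_exp_amgm (u : nat -> R) (s : R) (n : nat) :
  s <= sum_f_R0 u n ->
  INR (S n) * exp (s / INR (S n)) <= sum_f_R0 (fun i => exp (u i)) n.
Proof.
  intros Hs. set (m := s / INR (S n)).
  assert (Hn : 0 < INR (S n)) by (apply lt_0_INR; lia).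
  assert (Hm : INR (S n) * m = s) by (unfold m; field; lra).
  apply Rle_trans with (sum_f_R0 (fun i => u i * exp m + (1 - m) * exp m) n).
  - rewrite plus_sum, <- scal_sum, sum_cte.
    pose proof (exp_pos m). nra.
  - apply sum_Rle. intros i _.
    replace (u i) with (m + (u i - m)) at 2 by ring. rewrite exp_plus.
    pose proof (exp_pos m). pose proof (exp_ineq1_le (u i - m)). nra.
Qed.

(** * Paths avoiding a color *)

Section Avoid.
Variables (c : nat -> nat -> nat) (i : nat).

(** Only the two ends and the number of vertices are recorded, which is all that gluing paths at a
    node requires. *)
Inductive avoid_path : nat -> nat -> nat -> Prop :=
| avoid_one x : avoid_path x x 1
| avoid_cons x y z n :
    (x < y)%nat -> c x y <> i -> avoid_path y z n -> avoid_path x z (S n).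

Lemma avoid_path_le x y n : avoid_path x y n -> (x <= y)%nat.
Proof. induction 1; lia. Qed.

Lemma avoid_path_join x y n x' y' m :
  avoid_path x y n -> (y < x')%nat -> c y x' <> i -> avoid_path x' y' m ->
  avoid_path x y' (n + m).
Proof.
  induction 1; intros; simpl; econstructor; eauto.
Qed.

Lemma avoid_path_list x y n :
  avoid_path x y n ->
  exists p, length (x :: p) = n /\ strictly_increasing (x :: p) /\
    (forall v, In v (x :: p) -> (x <= v <= y)%nat) /\
    ~ In i (edge_colors c (x :: p)).
Proof.
  induction 1 as [x | x y z n Hxy Hc Hp [p (Hl & Hs & Hr & Hi)]].
  - exists nil. simpl. intuition lia.
  - exists (y :: p). split; [simpl in *; lia|]. split; [split; assumption|].
    split.
    + intros v [<-|Hv].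
      * pose proof (avoid_path_le _ _ _ Hp). lia.
      * specialize (Hr v Hv). lia.
    + intros [H|H]; auto.
Qed.

(** * The weighted binary search tree *)

(* The tree of depth [D] and offset [a] has the [2^(D+1) - 1] vertices strictly
   between [a] and [a + 2^(D+1)], and [a + 2^D] as its root; [w] collects the
   factors already contributed by the ancestors. *)
Variable p : R.

Definition factor (k : nat) : R := if Nat.eqb k i then p else 1 - p.

Fixpoint mass (D a : nat) (w : nat -> R) : R :=
  match D with
  | 0 => w (S a)
  | S D' => let z := (a + 2 ^ D)%nat in
      mass D' a (fun v => w v * factor (c v z))
      + mass D' z (fun v => w v * factor (c z v))
  end.

Lemma mass_ext D a w w' : (forall v, w v = w' v) -> mass D a w = mass D a w'.
Proof.
  revert a w w'. induction D as [|D IH]; intros a w w' H; cbn [mass].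
  - apply H.
  - f_equal; apply IH; intros v; rewrite H; reflexivity.
Qed.

Lemma mass_linear D a x y w w' :
  mass D a (fun v => x * w v + y * w' v) = x * mass D a w + y * mass D a w'.
Proof.
  revert a w w'. induction D as [|D IH]; intros a w w'; cbn [mass].
  - reflexivity.
  - set (z := (a + 2 ^ S D)%nat).
    rewrite (mass_ext D a _ (fun v => x * (w v * factor (c v z))
                                      + y * (w' v * factor (c v z))))
      by (intros; ring).
    rewrite (mass_ext D z _ (fun v => x * (w v * factor (c z v))
                                      + y * (w' v * factor (c z v))))
      by (intros; ring).
    rewrite !IH. ring.
Qed.

Definition ind (A : nat -> bool) (v : nat) : R := if A v then 1 else 0.

(** [G] belongs to the leaves that can be joined to the node, [B] to the others. Only [G] is
    identified, since only its leaves are passed to the induction on their own. *)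
Lemma mass_split D a (A : nat -> bool) (k : nat -> nat) :
  exists G B,
    G = mass D a (ind (fun v => A v && negb (Nat.eqb (k v) i))) /\
    mass D a (ind A) = G + B /\
    mass D a (fun v => ind A v * factor (k v)) = (1 - p) * G + p * B.
Proof.
  set (g := ind (fun v => A v && negb (Nat.eqb (k v) i))).
  set (b := ind (fun v => A v && Nat.eqb (k v) i)).
  exists (mass D a g), (mass D a b). repeat split.
  - rewrite (mass_ext D a _ (fun v => 1 * g v + 1 * b v)).
    + rewrite mass_linear. ring.
    + intros v. unfold g, b, ind. destruct (A v), (Nat.eqb (k v) i); simpl; ring.
  - rewrite <- mass_linear. apply mass_ext. intros v. unfold g, b, ind, factor.
    destruct (A v), (Nat.eqb (k v) i); simpl; ring.
Qed.

(** The set [A] is arbitrary so that the induction applies to the leaves joined to the root; the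
    ends of the resulting path lie in [A], hence are joined to it as well. The first alternative
    absorbs the case of an empty [A]. *)
Lemma mass_le_path (Hp : 0 <= p <= 1 / 2) D a (A : nat -> bool) :
  mass D a (ind A) <= 0 \/
  exists x y n, A x = true /\ A y = true /\ (a < x)%nat /\
    (y < a + 2 ^ S D)%nat /\ avoid_path x y n /\ mass D a (ind A) <= INR n.
Proof.
  revert a A. induction D as [|D IH]; intros a A.
  - simpl mass. unfold ind at 1 2. destruct (A (S a)) eqn:E; [right | left; lra].
    exists (S a), (S a), 1%nat. simpl. repeat split; auto; try lia; try lra.
    constructor.
  - cbn [mass]. set (z := (a + 2 ^ S D)%nat).
    assert (Hz : (a + 2 ^ S (S D) = z + 2 ^ S D)%nat)
      by (unfold z; rewrite (Nat.pow_succ_r' 2 (S D)); lia).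
    rewrite Hz.
    destruct (mass_split D a A (fun v => c v z)) as (Gl & Bl & HGl & HAl & ->).
    destruct (mass_split D z A (fun v => c z v)) as (Gr & Br & HGr & HAr & ->).
    set (m := _ + _).
    (* The alternatives are the joined leaves of both halves, the whole left half and the whole
       right half; [m] is their convex combination. *)
    assert (Hm : m <= Gl + Gr \/ m <= Gl + Bl \/ m <= Gr + Br).
    { destruct (Rle_lt_dec m (Gl + Gr)); auto.
      destruct (Rle_lt_dec m (Gl + Bl)); auto.
      destruct (Rle_lt_dec m (Gr + Br)); auto. exfalso.
      assert (m = (1 - 2 * p) * (Gl + Gr) + p * (Gl + Bl) + p * (Gr + Br))
        by (unfold m; ring).
      assert (0 <= (1 - 2 * p) * (m - (Gl + Gr))) by (apply Rmult_le_pos; lra).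
      assert (0 <= p * (m - (Gr + Br))) by (apply Rmult_le_pos; lra).
      (* A strict inequality of positive weight is required; for [p = 0] all the weight is on
         [Gl + Gr]. *)
      destruct (Rle_lt_or_eq_dec _ _ (proj1 Hp)) as [h | <-]; [|lra].
      assert (0 < p * (m - (Gl + Bl))) by (apply Rmult_lt_0_compat; lra).
      lra. }
    destruct Hm as [Hm | [Hm | Hm]].
    + destruct (IH a (fun v => A v && negb (Nat.eqb (c v z) i)))
        as [Hl | (x & y & n & Hx & Hy & Hax & Hyz & P & Hn)];
      destruct (IH z (fun v => A v && negb (Nat.eqb (c z v) i)))
        as [Hr | (x' & y' & n' & Hx' & Hy' & Hzx & Hyb & P' & Hn')];
      rewrite <- ?HGl, <- ?HGr in *;
      repeat match goal with
        | H : _ && _ = true |- _ => apply andb_prop in H; destruct H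
        | H : negb (Nat.eqb _ _) = true |- _ =>
            apply negb_true_iff, Nat.eqb_neq in H
        end.
      * left. lra.
      * right. exists x', y', n'. repeat split; auto; lia || lra.
      * right. exists x, y, n. repeat split; auto; lia || lra.
      (* Both [y] and [x'] are joined to [z], which links the two paths and is the extra vertex in
         [S n']. *)
      * right. exists x, y', (n + S n')%nat. repeat split; auto; try lia.
        -- apply avoid_path_join with y z; auto.
           apply avoid_cons with x'; auto.
        -- rewrite plus_INR, S_INR. lra.
    + destruct (IH a A) as [Hl | (x & y & n & Hx & Hy & Hax & Hyz & P & Hn)].
      * left. lra.
      * right. exists x, y, n. repeat split; auto; lia || lra.
    + destruct (IH z A) as [Hl | (x & y & n & Hx & Hy & Hax & Hyz & P & Hn)].
      * left. lra.
      * right. exists x, y, n. repeat split; auto; lia || lra.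
Qed.

End Avoid.

(** * Averaging the masses over the colors *)

Lemma factor_exp i p k (Hp : 0 < p < 1) :
  factor i p k = exp (if Nat.eqb k i then ln p else ln (1 - p)).
Proof.
  unfold factor. destruct (Nat.eqb k i); rewrite exp_ln; lra.
Qed.

(** With weights kept as exponentials, each ancestor raises the sum over the colors of the
    logarithms at a leaf by exactly [t], because its edge has exactly one color. AM-GM then gives
    the same bound at each of the [2 ^ D] leaves. *)
Lemma sum_mass_ge N n c p (Hp : 0 < p < 1) (Hc : is_coloring N (S n) c)
    D a (u : nat -> nat -> R) (s : R) :
  (a + 2 ^ S D <= S N)%nat ->
  (forall v, (a < v < a + 2 ^ S D)%nat -> s <= sum_f_R0 (fun i => u i v) n) ->
  INR (S n) * 2 ^ D
    * exp ((s + INR D * (ln p + INR n * ln (1 - p))) / INR (S n))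
  <= sum_f_R0 (fun i => mass c i p D a (fun v => exp (u i v))) n.
Proof.
  set (t := ln p + INR n * ln (1 - p)).
  revert a u s. induction D as [|D IH]; intros a u s Ha Hu.
  - cbn [mass]. rewrite pow_O, Rmult_1_r. simpl (INR 0).
    replace (s + 0 * t) with s by ring.
    apply (sum_exp_amgm (fun i => u i (S a))), Hu. simpl. lia.
  - cbn [mass]. set (z := (a + 2 ^ S D)%nat).
    assert (Hz : (a + 2 ^ S (S D) = z + 2 ^ S D)%nat)
      by (unfold z; rewrite (Nat.pow_succ_r' 2 (S D)); lia).
    assert (Hpos : (0 < 2 ^ S D)%nat) by (apply Nat.neq_0_lt_0, Nat.pow_nonzero; lia).
    rewrite Hz in Ha, Hu.
    set (lf := fun i k : nat => if Nat.eqb k i then ln p else ln (1 - p)).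
    assert (Hlf : forall k, (k < S n)%nat -> sum_f_R0 (fun i => lf i k) n = t)
      by (intros k Hk; apply sum_pick; lia).
    (* One statement for both halves: [b] is [a] or [z], and [k v] is the color of the edge between
       [v] and [z]. *)
    assert (Hstep : forall b (k : nat -> nat), (a <= b)%nat -> (b <= z)%nat ->
      (forall v, (b < v < b + 2 ^ S D)%nat -> (k v < S n)%nat) ->
      INR (S n) * 2 ^ D * exp ((s + INR (S D) * t) / INR (S n))
      <= sum_f_R0 (fun i => mass c i p D b
           (fun v => exp (u i v) * factor i p (k v))) n).
    { intros b k Hab Hbz Hk.
      rewrite (sum_eq _ (fun i => mass c i p D b
                 (fun v => exp (u i v + lf i (k v))))).
      - replace (s + INR (S D) * t) with ((s + t) + INR D * t)
          by (rewrite S_INR; ring).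
        apply (IH b (fun i v => u i v + lf i (k v))); [lia|].
        intros v Hv. rewrite plus_sum, Hlf by auto.
        apply Rplus_le_compat_r, Hu. lia.
      - intros i _. apply mass_ext. intros v.
        rewrite exp_plus, (factor_exp i p (k v) Hp). reflexivity. }
    rewrite plus_sum. simpl pow.
    assert (Hl := Hstep a (fun v => c v z)).
    assert (Hr := Hstep z (fun v => c z v)).
    set (e := exp _) in *. simpl Nat.pow in Hl, Hr.
    match goal with |- _ <= ?l + ?r => assert (INR (S n) * 2 ^ D * e <= l /\
      INR (S n) * 2 ^ D * e <= r) end.
    { split; [apply Hl | apply Hr]; try lia; intros v Hv; apply Hc;
        simpl Nat.pow in *; lia. }
    lra.
Qed.

(** For [p = 1 / q], some color has at least the average mass; its exponent is estimated by
    [ln p = - ln q] and [(q - 1) * ln (1 - p) >= -1]. *)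
Lemma avoid_path_exists N n c D :
  (1 <= n)%nat -> is_coloring N (S n) c -> (2 ^ S D <= N)%nat ->
  exists i x y m, (i <= n)%nat /\ (1 <= x)%nat /\ (y <= N)%nat /\
    avoid_path c i x y m /\
    exp (INR D * (ln 2 - (ln (INR (S n)) + 1) / INR (S n))) <= INR m.
Proof.
  intros Hn Hc HD.
  set (q := INR (S n)). set (p := / q).
  assert (Hq : 2 <= q) by (unfold q; rewrite S_INR; apply le_INR in Hn;
                           simpl in Hn; lra).
  assert (Hnq : INR n = q - 1) by (unfold q; rewrite S_INR; ring).
  assert (Hp : 0 < p <= 1 / 2).
  { unfold p. split; [apply Rinv_0_lt_compat; lra|].
    replace (1 / 2) with (/ 2) by field. apply Rinv_le_contravar; lra. }
  assert (Hpq : q * p = 1) by (unfold p; field; lra).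
  (* This is [ln (q / (q - 1)) <= 1 / (q - 1)]. *)
  assert (Hln1p : - 1 <= (q - 1) * ln (1 - p)).
  { assert (H := exp_ineq1_le (- ln (1 - p))).
    rewrite exp_Ropp, exp_ln in H by lra.
    assert (E : (q - 1) * / (1 - p) = q).
    { replace (1 - p) with ((q - 1) * p) by lra. unfold p. field. lra. }
    nra. }
  destruct (sum_ge_exists (fun i => mass c i p D 0 (fun v => exp 0))
              (2 ^ D * exp ((0 + INR D * (ln p + INR n * ln (1 - p))) / q)) n)
    as [i [Hi HM]].
  { rewrite <- Rmult_assoc.
    apply (sum_mass_ge N n c p) with (u := fun _ _ => 0); auto; try lra; try lia.
    intros v _. rewrite sum_cte. lra. }
  cbv beta in HM.
  rewrite (mass_ext _ _ _ _ _ _ (ind (fun _ => true))) in HM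
    by (intros; unfold ind; apply exp_0).
  assert (HE : exp (INR D * (ln 2 - (ln q + 1) / q))
               <= mass c i p D 0 (ind (fun _ => true))).
  { eapply Rle_trans; [|exact HM].
    replace (2 ^ D) with (exp (INR D * ln 2))
      by (rewrite <- (Rpower_pow D 2) by lra; reflexivity).
    rewrite <- exp_plus.
    assert (INR D * (ln 2 - (ln q + 1) / q) <=
            INR D * ln 2 + (0 + INR D * (ln p + INR n * ln (1 - p))) / q).
    { replace (ln p) with (- ln q) by (unfold p; rewrite ln_Rinv; lra).
      rewrite Hnq. unfold Rdiv. fold p.
      assert (0 <= INR D) by apply pos_INR.
      assert (0 <= INR D * p * (1 + (q - 1) * ln (1 - p)))
        by (repeat apply Rmult_le_pos; lra).
      lra. }
    destruct (Rle_lt_or_eq_dec _ _ H) as [h| ->];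
      [left; apply exp_increasing, h | lra]. }
  destruct (mass_le_path c i p ltac:(lra) D 0 (fun _ => true))
    as [H0 | (x & y & m & _ & _ & Hx & Hy & P & Hm)].
  - pose proof (exp_pos (INR D * (ln 2 - (ln q + 1) / q))). lra.
  - exists i, x, y, m. rewrite Nat.add_0_l in Hy. repeat split; auto; lia || lra.
Qed.

(** * Few vertices *)

Lemma edge_colors_length c p : length (edge_colors c p) = pred (length p).
Proof.
  induction p as [|x [|y p] IH]; try reflexivity.
  simpl in *. rewrite IH. reflexivity.
Qed.

Lemma strictly_increasing_seq N a : strictly_increasing (seq a N).
Proof.
  revert a. induction N as [|[|N] IH]; intros a; simpl; auto.
  split; [lia | apply (IH (S a))].
Qed.

Lemma exists_missing_color q (l : list nat) :
  (length l < q)%nat -> exists k, (k < q)%nat /\ ~ In k l.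
Proof.
  intros H.
  destruct (Exists_dec (fun k => ~ In k l) (seq 0 q)) as [E|E].
  - intros k. destruct (in_dec Nat.eq_dec k l); auto.
  - apply Exists_exists in E. destruct E as [k [Hk HI]].
    apply in_seq in Hk. exists k. split; [lia | exact HI].
  - exfalso. apply Forall_Exists_neg in E. rewrite Forall_forall in E.
    assert (HI : incl (seq 0 q) l).
    { intros k Hk. specialize (E k Hk).
      destruct (in_dec Nat.eq_dec k l); tauto. }
    apply NoDup_incl_length in HI; [|apply seq_NoDup].
    rewrite length_seq in HI. lia.
Qed.

(** * The two ranges of [N] and the constants *)

Theorem theorem1p5 :
  exists C : R, C > 0 /\
    forall (q N : nat) (c : nat -> nat -> nat),
      (4 <= q)%nat -> (1 <= N)%nat -> is_coloring N q c ->
      exists p : list nat,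
        monotone_path N p /\ color_avoiding q c p /\
        INR (length p) >= Rpower (INR N) (1 - C / sqrt (log2 (INR q))).
Proof.
  exists 100. split; [lra|]. intros q N c Hq HN Hc.
  set (s := sqrt (log2 (INR q))). set (l := ln (INR q)).
  assert (Hq4 : 4 <= INR q) by (apply le_INR in Hq; simpl in Hq; lra).
  assert (Hln2 : 1 / 2 <= ln 2 <= 1).
  { pose proof ln_lt_2. split; [lra|].
    pose proof (exp_ineq1_le (ln 2)) as H2. rewrite exp_ln in H2; lra. }
  assert (Hl : 2 * ln 2 <= l).
  { replace (2 * ln 2) with (ln (2 * 2)) by (rewrite ln_mult; lra).
    unfold l. destruct (Rle_lt_or_eq_dec _ _ Hq4) as [h|h].
    - left. apply ln_increasing; lra.
    - right. f_equal. lra. }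
  assert (Hlog : log2 (INR q) * ln 2 = l) by (unfold log2, l; field; lra).
  assert (Hs2 : s * s = log2 (INR q)) by (apply sqrt_sqrt; nra).
  assert (Hs : 1 <= s).
  { unfold s. rewrite <- sqrt_1. apply sqrt_le_1_alt. nra. }
  (* Since [l = s * s * ln 2], this turns losses of order [1 / l] into losses of order [1 / s]. *)
  assert (Hsl : s <= 2 * l) by nra.
  destruct (Nat.le_gt_cases N q) as [HNq | HNq].
  - exists (seq 1 N). split; [|split].
    + split; [destruct N; [lia | discriminate]|].
      split; [|apply strictly_increasing_seq].
      intros v Hv. apply in_seq in Hv. lia.
    + apply exists_missing_color. rewrite edge_colors_length, length_seq. lia.
    + rewrite length_seq. apply Rle_ge.
      assert (HN1 : 1 <= INR N) by (apply le_INR in HN; simpl in HN; lra).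
      rewrite <- (Rpower_1 (INR N)) at 2 by lra.
      apply Rle_Rpower; [lra|].
      assert (0 <= 100 / s) by (apply Rlt_le, Rdiv_lt_0_compat; lra). lra.
  - destruct q as [|n]; [lia|].
    (* A tree of depth [D] occupies [2 ^ S D - 1] vertices, so [S D] is the rounded-down logarithm
       of [N]. *)
    set (D := pred (Nat.log2 N)).
    assert (HL : (2 <= Nat.log2 N)%nat)
      by (change 2%nat with (Nat.log2 4); apply Nat.log2_le_mono; lia).
    assert (HD : (2 ^ S D <= N < 2 ^ S (S D))%nat).
    { replace (S D) with (Nat.log2 N) by (unfold D; lia).
      apply Nat.log2_spec. lia. }
    destruct (avoid_path_exists N n c D) as (i & x & y & m & Hi & Hx & Hy & P & Hm);
      auto; try lia.
    destruct (avoid_path_list _ _ _ _ _ P) as (p & Hlen & Hinc & Hr & Havoid).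
    exists (x :: p). split; [|split].
    + split; [discriminate|]. split; [|exact Hinc].
      intros v Hv. specialize (Hr v Hv). lia.
    + exists i. split; [lia | exact Havoid].
    + rewrite Hlen. apply Rle_ge. eapply Rle_trans; [|exact Hm].
      unfold Rpower.
      set (L := ln (INR N)). fold l. set (Q := INR (S n)) in *.
      assert (HNq' : Q < INR N) by (apply lt_INR; lia).
      assert (HlL : l <= L) by (left; apply ln_increasing; lra).
      assert (HLD : L <= (INR D + 2) * ln 2).
      { replace (INR D + 2) with (INR (S (S D))) by (rewrite !S_INR; ring).
        rewrite <- ln_pow by lra. left. apply ln_increasing; [lra|].
        rewrite <- (pow_INR 2). apply lt_INR. lia. }
      assert (HDL : INR D * ln 2 <= L).
      { apply Rle_trans with (INR (S D) * ln 2).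
        - rewrite S_INR. lra.
        - rewrite <- ln_pow by lra.
          destruct (Rle_lt_or_eq_dec (2 ^ S D) (INR N)) as [h|h].
          + rewrite <- (pow_INR 2). apply le_INR. lia.
          + left. apply ln_increasing; [apply pow_lt; lra | exact h].
          + right. rewrite h. reflexivity. }
      (* Square [exp (l / 2) >= 1 + l / 2]. *)
      assert (HQl : l * l / 4 <= Q).
      { replace Q with (exp (l / 2) * exp (l / 2)).
        - pose proof (exp_ineq1_le (l / 2)). nra.
        - rewrite <- exp_plus. replace (l / 2 + l / 2) with l by field.
          apply exp_ln. lra. }
      assert (HD0 : 0 <= INR D) by apply pos_INR.
      assert (Hls : / l <= 2 * / s).
      { replace (2 * / s) with (/ (s / 2)) by (field; lra).
        apply Rinv_le_contravar; lra. }
      assert (HlQ : (l + 1) / Q <= 8 * / l).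
      { apply Rmult_le_reg_r with (Q * l); [nra|].
        replace ((l + 1) / Q * (Q * l)) with ((l + 1) * l) by (field; lra).
        replace (8 * / l * (Q * l)) with (8 * Q) by (field; lra). nra. }
      (* Replacing [INR D * ln 2] by [L] costs at most [2 * ln 2 <= 2 * L / l <= 4 * L / s], and the
         term in [(l + 1) / Q] at most [32 * L / s]; the constant 100 exceeds the total of 36. *)
      assert (H : (1 - 100 / s) * L <= INR D * (ln 2 - (l + 1) / Q)).
      { assert (HLl : 1 <= L * / l).
        { apply Rmult_le_reg_r with l; [lra|].
          rewrite Rmult_assoc, Rinv_l; lra. }
        assert (INR D * ((l + 1) / Q) <= (2 * L) * (16 * / s)).
        { apply Rmult_le_compat; try lra; try nra.
          apply Rlt_le, Rdiv_lt_0_compat; lra. }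
        assert (L * / l <= L * (2 * / s)) by (apply Rmult_le_compat_l; lra).
        assert (0 <= L * / s)
          by (apply Rmult_le_pos; [lra | apply Rlt_le, Rinv_0_lt_compat; lra]).
        unfold Rdiv at 1. nra. }
      destruct (Rle_lt_or_eq_dec _ _ H) as [h|h];
        [left; apply exp_increasing, h | right; rewrite h; reflexivity].
Qed.
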